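(* Let $K$ be a field and let $d_1,d_2,k\ge 0$ be integers with $k\le \min(d_1,d_2)$. There is a (finite) decomposition $\mathrm{Poly}_1^{(d_1-k,d_2-k)}=\bigsqcup_i C_i$ into locally closed subvarieties, where each $C_i$ is isomorphic to a product of $\mathbb{A}^1$'s and $\mathbb{G}_m$'s, such that the surjective morphism $$\Psi:\mathrm{Poly}_1^{(d_1-k,d_2-k)}\times\mathbb{A}^k\to R_{1,k}^{(d_1,d_2)}\setminus R_{1,k+1}^{(d_1,d_2)},\qquad \Psi(f_1,f_2,g)=(f_1g,f_2g),$$ is an isomorphism (onto its image, a locally closed subvariety of the target) when restricted to each $C_i\times\mathbb{A}^k$.
   Context: All varieties are over the base field $K$. The affine space $\mathbb{A}^m\cong\mathrm{Sym}^m(\mathbb{A}^1)$ is identified with the space of monic polynomials of degree $m$ in one variable $z$, via $(a_1,\ldots,a_m)\leftrightarrow z^m+a_1z^{m-1}+\cdots+a_m$. $\mathrm{Poly}_1^{(e_1,e_2)}\subset\mathbb{A}^{e_1}\times\mathbb{A}^{e_2}$ is the open subvariety parameterizing pairs of coprime monic polynomials of degrees $e_1,e_2$. $R_{1,\ell}^{(d_1,d_2)}\subset\mathbb{A}^{d_1}\times\mathbb{A}^{d_2}$ is the closed subvariety (with reduced structure) of pairs of monic polynomials of degrees $d_1,d_2$ which share a common factor of degree $\ge\ell$; it is empty when $\ell>\min(d_1,d_2)$. Locally closed subsets are given their reduced structure. The morphism $\Psi$ is the restriction of the multiplication morphism $\mathbb{A}^{d_1-k}\times\mathbb{A}^{d_2-k}\times\mathbb{A}^k\to\mathbb{A}^{d_1}\times\mathbb{A}^{d_2}$,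 $(f_1,f_2,g)\mapsto(f_1g,f_2g)$. *)

(* Defs.v *)
From HB Require Import structures.
From mathcomp Require Import all_boot all_order all_algebra.
From mathcomp.multinomials Require Import mpoly.

Set Implicit Arguments.
Unset Strict Implicit.
Unset Printing Implicit Defensive.

Import GRing.Theory.
Local Open Scope ring_scope.

(* Reduced quasi-affine K-varieties, in the classical (Weil) language: L is an
   algebraically closed field, iota : K -> L, and a reduced locally closed
   subvariety of the affine space A^n over K is given by its set of L-points,
   a subset of L^n cut out by polynomials with coefficients in K.  Since all
   the varieties are reduced, such a set determines the K-subvariety, and a
   K-morphism is determined by the map it induces on L-points.  K need
   be neither perfect nor infinite. *)

Definition aset (L : fieldType) (n : nat) : Type := 'rV[L]_n -> Prop.

Section Sets.
Variable L : fieldType.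

Definition asubset n (X Y : aset L n) : Prop := forall x, X x -> Y x.

Definition affine n : aset L n := fun _ => True.

(* A^n x A^m is A^(n + m), by concatenation of coordinates. *)
Definition aprod n m (X : aset L n) (Y : aset L m) : aset L (n + m) :=
  fun v => X (lsubmx v) /\ Y (rsubmx v).

Definition adiff n (X Y : aset L n) : aset L n := fun x => X x /\ ~ Y x.

Definition aimage n m (f : 'rV[L]_n -> 'rV[L]_m) (X : aset L n) : aset L m :=
  fun y => exists2 x, X x & y = f x.

Definition asurjective n m (X : aset L n) (Y : aset L m)
    (f : 'rV[L]_n -> 'rV[L]_m) : Prop :=
  forall y, Y y -> exists2 x, X x & f x = y.

(* The product of a copies of A^1 and b copies of G_m = A^1 \ {0}. *)
Definition affine_torus (a b : nat) : aset L (a + b) :=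
  fun v => forall j : 'I_b, v 0 (rshift a j) != 0.

End Sets.

Section Varieties.
Variables (K : fieldType) (L : closedFieldType) (iota : {rmorphism K -> L}).

Definition evalK n (p : {mpoly K[n]}) (x : 'rV[L]_n) : L :=
  mmap iota (fun i => x 0 i) p.

Definition zero_locus n (S : seq {mpoly K[n]}) : aset L n :=
  fun x => forall p, p \in S -> evalK p x = 0.

(* Intersection of a Zariski-closed set with a Zariski-open one, over K. *)
Definition locally_closed n (X : aset L n) : Prop :=
  exists S T : seq {mpoly K[n]},
    forall x, X x <-> zero_locus S x /\ ~ zero_locus T x.

Definition regular n (X : aset L n) (f : 'rV[L]_n -> L) : Prop :=
  forall x, X x -> exists p q : {mpoly K[n]}, evalK q x != 0 /\
    forall y, X y -> evalK q y != 0 -> f y = evalK p y / evalK q y.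

Definition morphism n m (X : aset L n) (Y : aset L m)
    (f : 'rV[L]_n -> 'rV[L]_m) : Prop :=
  (forall x, X x -> Y (f x)) /\ (forall j, regular X (fun x => f x 0 j)).

Definition isomorphism n m (X : aset L n) (Y : aset L m)
    (f : 'rV[L]_n -> 'rV[L]_m) : Prop :=
  morphism X Y f /\
  exists g : 'rV[L]_m -> 'rV[L]_n,
    [/\ morphism Y X g, forall x, X x -> g (f x) = x
      & forall y, Y y -> f (g y) = y].

Definition isomorphic n m (X : aset L n) (Y : aset L m) : Prop :=
  exists f, isomorphism X Y f.

End Varieties.

Section Polynomials.
Variable L : fieldType.

(* (a_1, ..., a_m) |-> z^m + a_1 z^(m-1) + ... + a_m, with a_(i+1) = a 0 i. *)
Definition monic_of m (a : 'rV[L]_m) : {poly L} :=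
  'X^m + \sum_(i < m) a 0 i *: 'X^(m - i.+1).

(* The inverse of monic_of on monic polynomials of degree m. *)
Definition coords m (p : {poly L}) : 'rV[L]_m := \row_(i < m) p`_(m - i.+1).

Definition Poly1 e1 e2 : aset L (e1 + e2) :=
  fun v => coprimep (monic_of (lsubmx v)) (monic_of (rsubmx v)).

(* l < size h says that deg h >= l. *)
Definition R1 l d1 d2 : aset L (d1 + d2) :=
  fun v => exists h : {poly L},
    [/\ (l < size h)%N, h %| monic_of (lsubmx v) & h %| monic_of (rsubmx v)].

Definition Psi d1 d2 k (v : 'rV[L]_((d1 - k) + (d2 - k) + k)) :
    'rV[L]_(d1 + d2) :=
  let f1 := monic_of (lsubmx (lsubmx v)) in
  let f2 := monic_of (rsubmx (lsubmx v)) in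
  let g := monic_of (rsubmx v) in
  row_mx (coords d1 (f1 * g)) (coords d2 (f2 * g)).

End Polynomials.

Arguments affine L n : clear implicits.
Arguments affine_torus L a b : clear implicits.
Arguments Poly1 L e1 e2 : clear implicits.
Arguments R1 L l d1 d2 : clear implicits.
Arguments Psi L d1 d2 k v : clear implicits.

(* For k <= d1, d2, Psi is (f1, f2, g) |-> (f1 g, f2 g) on monic polynomials. *)
Lemma monic_of_monic (L : fieldType) m (a : 'rV[L]_m) :
  monic_of a \is monic /\ size (monic_of a) = m.+1.
Proof.
rewrite /monic_of; set s := \sum_(i < m) _; have lt_s : (size s < size ('X^m : {poly L}))%N.
  rewrite size_polyXn ltnS; apply: (leq_trans (size_sum _ _ _)).
  apply/bigmax_leqP => i _; apply: (leq_trans (size_scale_leq _ _)).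
  by rewrite size_polyXn -subSn // subSS leq_subr.
split; last by rewrite size_polyDl // size_polyXn.
by rewrite monicE lead_coefDl // lead_coefXn.
Qed.

Lemma coordsK (L : fieldType) m (p : {poly L}) :
  p \is monic -> size p = m.+1 -> monic_of (coords m p) = p.
Proof.
move=> mp sp; have lp : p`_m = 1 by move/monicP: mp; rewrite lead_coefE sp.
rewrite -[RHS]coefK sp poly_def big_ord_recr /= lp scale1r [RHS]addrC.
rewrite /monic_of; congr (_ + _); rewrite [RHS](reindex_inj rev_ord_inj) /=.
by apply: eq_bigr => i _; rewrite mxE.
Qed.

Lemma PsiE (L : fieldType) d1 d2 k v : (k <= minn d1 d2)%N ->
  let f1 := monic_of (lsubmx (lsubmx v)) in
  let f2 := monic_of (rsubmx (lsubmx v)) in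
  let g := monic_of (rsubmx v) in
  monic_of (lsubmx (Psi L d1 d2 k v)) = f1 * g /\
  monic_of (rsubmx (Psi L d1 d2 k v)) = f2 * g.
Proof.
rewrite leq_min => /andP[k1 k2] f1 f2 g; rewrite row_mxKl row_mxKr.
have [[m1 s1] [m2 s2] [mg sg]] :
  [/\ f1 \is monic /\ size f1 = (d1 - k).+1,
      f2 \is monic /\ size f2 = (d2 - k).+1 & g \is monic /\ size g = k.+1].
  by split; apply: monic_of_monic.
have g0 := monic_neq0 mg.
split; apply: coordsK; rewrite ?monicMl ?size_monicM //.
- by rewrite s1 sg addnS /= addSn subnK.
- by rewrite s2 sg addnS /= addSn subnK.
Qed.

(* Main.v *)
Require Import Defs.
From HB Require Import structures.
From mathcomp Require Import all_boot all_order all_algebra.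
From mathcomp.multinomials Require Import mpoly.

Set Implicit Arguments.
Unset Strict Implicit.
Unset Printing Implicit Defensive.

Import GRing.Theory.
Local Open Scope ring_scope.

(** Psi is bijective onto its target because a pair (F1, F2) whose gcd has
    degree k is (f1 g, f2 g) for its monic gcd g and a unique coprime pair; so
    the inverse is (F1, F2) |-> (F1 / g, F2 / g, g) (lemmas [unmulK] and
    [Psi_unmul]).  It is in general not a morphism, because the coefficients of g
    need not be regular functions of those of F1 and F2.  They become regular as
    soon as the degrees of all the remainders in Euclid's algorithm are fixed:
    division by a monic polynomial is polynomial in the coefficients, and a
    remainder of known degree j is made monic by dividing by its coefficient
    of index j, which then vanishes nowhere ([poly_fraction_mgcd],
    [fraction_unmul]).

    So stratify the coprime pairs by the sequence s of degrees of the
    remainders.  A stratum is cut out by vanishing and nonvanishing of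
    coefficients of successive remainders, hence is locally closed
    ([locally_closed_euclid]).  If p and q are monic of degrees d >= e with
    p = m q + c r, where r is monic, then m is an arbitrary monic polynomial of
    degree d - e, c an arbitrary unit, and (q, r) an arbitrary pair in a shorter
    stratum; by induction the stratum is a product of affine lines and of one
    G_m for each remainder ([stratum_torus]).  Its affine factor has dimension
    (d - e) + (e - j) + ... = d.

    Finally, multiplying both polynomials by g multiplies every remainder by g,
    hence shifts every degree in s by k ([euclidM]).  So Psi maps the stratum
    of s times A^k onto the stratum of the shifted sequence
    ([image_stratum]), which is locally closed and on which the inverse of Psi
    is regular. *)

(** * Global fractions and locally closed sets *)

Section Fractions.
Variables (K : fieldType) (L : closedFieldType) (iota : {rmorphism K -> L}).

Lemma evalK0 n (x : 'rV[L]_n) : evalK iota 0 x = 0.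
Proof. exact: rmorph0. Qed.

Lemma evalK1 n (x : 'rV[L]_n) : evalK iota 1 x = 1.
Proof. exact: rmorph1. Qed.

Lemma evalKD n (p q : {mpoly K[n]}) x :
  evalK iota (p + q) x = evalK iota p x + evalK iota q x.
Proof. exact: rmorphD. Qed.

Lemma evalKN n (p : {mpoly K[n]}) x : evalK iota (- p) x = - evalK iota p x.
Proof. exact: rmorphN. Qed.

Lemma evalKM n (p q : {mpoly K[n]}) x :
  evalK iota (p * q) x = evalK iota p x * evalK iota q x.
Proof. exact: rmorphM. Qed.

Lemma evalK_coord n i (x : 'rV[L]_n) : evalK iota 'X_i x = x 0 i.
Proof. by rewrite /evalK mmapX mmap1U. Qed.

(** A regular function given by one quotient on the whole of X.  Every function
    needed below has this form, and working with a single quotient avoids all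
    gluing of local expressions. *)
Definition fraction n (X : aset L n) (f : 'rV[L]_n -> L) : Prop :=
  exists p q : {mpoly K[n]},
    forall x, X x -> evalK iota q x != 0 /\ f x = evalK iota p x / evalK iota q x.

Section Closure.
Variables (n : nat) (X : aset L n).
Implicit Types f g : 'rV[L]_n -> L.

Lemma fraction_regular f : fraction X f -> regular iota X f.
Proof.
move=> [p [q fE]] x Xx; exists p, q; split; first by case: (fE x Xx).
by move=> y Xy _; case: (fE y Xy).
Qed.

Lemma sub_fraction (Y : aset L n) f :
  asubset X Y -> fraction Y f -> fraction X f.
Proof. by move=> XY [p [q fE]]; exists p, q => x /XY/fE. Qed.

Lemma eq_fraction f g :
  (forall x, X x -> f x = g x) -> fraction X f -> fraction X g.
Proof. by move=> fg [p [q fE]]; exists p, q => x Xx; rewrite -fg //; apply: fE. Qed.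

Lemma fraction0 : fraction X (fun _ => 0).
Proof. by exists 0, 1 => x _; rewrite evalK0 evalK1 mul0r oner_neq0. Qed.

Lemma fraction1 : fraction X (fun _ => 1).
Proof. by exists 1, 1 => x _; rewrite evalK1 divr1 oner_neq0. Qed.

Lemma fraction_coord i : fraction X (fun x => x 0 i).
Proof. by exists 'X_i, 1 => x _; rewrite evalK1 evalK_coord divr1 oner_neq0. Qed.

Lemma fractionD f g :
  fraction X f -> fraction X g -> fraction X (fun x => f x + g x).
Proof.
move=> [p1 [q1 fE]] [p2 [q2 gE]]; exists (p1 * q2 + p2 * q1), (q1 * q2) => x Xx.
have [[q1n ->] [q2n ->]] := (fE x Xx, gE x Xx).
by rewrite evalKD !evalKM mulf_neq0 // addf_div.
Qed.

Lemma fractionN f : fraction X f -> fraction X (fun x => - f x).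
Proof.
move=> [p [q fE]]; exists (- p), q => x /fE[qn ->].
by rewrite evalKN mulNr.
Qed.

Lemma fractionM f g :
  fraction X f -> fraction X g -> fraction X (fun x => f x * g x).
Proof.
move=> [p1 [q1 fE]] [p2 [q2 gE]]; exists (p1 * p2), (q1 * q2) => x Xx.
have [[q1n ->] [q2n ->]] := (fE x Xx, gE x Xx).
by rewrite !evalKM mulf_neq0 // mulf_div.
Qed.

Lemma fractionV f : (forall x, X x -> f x != 0) ->
  fraction X f -> fraction X (fun x => (f x)^-1).
Proof.
move=> fn [p [q fE]]; exists q, p => x Xx; have [qn fx] := fE x Xx.
split; last by rewrite fx invf_div.
by apply: contraNneq (fn x Xx) => p0; rewrite fx p0 mul0r.
Qed.

Lemma fraction_sum m (f : 'I_m -> 'rV[L]_n -> L) :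
  (forall i, fraction X (f i)) -> fraction X (fun x => \sum_(i < m) f i x).
Proof.
elim: m f => [|m IHm] f ff.
  by apply: eq_fraction fraction0 => x _; rewrite big_ord0.
apply: (@eq_fraction (fun x => f ord0 x + \sum_(i < m) f (lift ord0 i) x)).
  by move=> x _; rewrite big_ord_recl.
by apply: fractionD => //; apply: IHm.
Qed.

End Closure.

Lemma morphism_fraction n m (X : aset L n) (Y : aset L m) f :
    (forall x, X x -> Y (f x)) ->
    (forall j, fraction X (fun x => f x 0 j)) ->
  morphism iota X Y f.
Proof. by move=> XY ff; split=> // j; apply: fraction_regular. Qed.

Lemma locally_closed_affine n : locally_closed iota (affine L n).
Proof.
exists [::], [:: 1] => x; split=> // _; split=> // /(_ 1).
by rewrite mem_head evalK1 => /(_ isT)/eqP; rewrite oner_eq0.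
Qed.

Lemma eq_locally_closed n (X Y : aset L n) :
  (forall x, X x <-> Y x) -> locally_closed iota X -> locally_closed iota Y.
Proof. by move=> XY [S [T XE]]; exists S, T => x; rewrite -XY. Qed.

Lemma locally_closed_eq0 n (X : aset L n) f :
    fraction X f -> locally_closed iota X ->
  locally_closed iota (fun x => X x /\ f x = 0).
Proof.
move=> [p [q fE]] [S [T XE]]; exists (p :: S), T => x.
have f0 : X x -> (f x = 0 <-> evalK iota p x = 0).
  move=> Xx; have [qn ->] := fE x Xx; split=> [/eqP|->]; last by rewrite mul0r.
  by rewrite mulf_eq0 invr_eq0 (negPf qn) orbF => /eqP.
split=> [[Xx /(f0 Xx) px]|[Zx nTx]].
  have [Sx Tx] := (XE x).1 Xx; split=> // r; rewrite inE => /predU1P[-> //|].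
  exact: Sx.
have Xx : X x by apply/XE; split=> // r rS; apply: Zx; rewrite inE rS orbT.
by split=> //; apply/(f0 Xx); apply: Zx; rewrite mem_head.
Qed.

(** The open part of X has to be intersected with f != 0; products with the
    numerator of f describe this intersection. *)
Lemma locally_closed_neq0 n (X : aset L n) f :
    fraction X f -> locally_closed iota X ->
  locally_closed iota (fun x => X x /\ f x != 0).
Proof.
move=> [p [q fE]] [S [T XE]]; exists S, [seq p * t | t <- T] => x.
have f0 : X x -> (f x != 0) = (evalK iota p x != 0).
  move=> Xx; have [qn ->] := fE x Xx.
  by rewrite mulf_eq0 invr_eq0 (negPf qn) orbF.
split=> [[Xx fx]|[Sx nTx]].
  have [Sx Tx] := (XE x).1 Xx; split=> // pTx; apply: Tx => t tT.
  have /eqP := pTx _ (map_f _ tT).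
  by rewrite evalKM mulf_eq0 -[_ == 0]negbK -f0 // fx => /eqP.
have Xx : X x.
  by apply/XE; split=> // Tx; apply: nTx => _ /mapP[t /Tx tx ->]; rewrite evalKM tx mulr0.
split=> //; rewrite f0 //; apply/eqP => px; apply: nTx => _ /mapP[t _ ->].
by rewrite evalKM px mul0r.
Qed.

Lemma locally_closed_all_eq0 n (X : aset L n) m (f : nat -> 'rV[L]_n -> L) :
    (forall i, fraction X (f i)) -> locally_closed iota X ->
  locally_closed iota (fun x => X x /\ forall i, (i < m)%N -> f i x = 0).
Proof.
move=> ff; elim: m => [|m IHm] lcX.
  by apply: eq_locally_closed lcX => x; split=> [|[]].
apply: (@eq_locally_closed _
    (fun x => (X x /\ forall i, (i < m)%N -> f i x = 0) /\ f m x = 0)).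
  move=> x; split=> [[[Xx fx] fmx]|[Xx fx]]; split=> //.
  - by move=> i; rewrite ltnS leq_eqVlt => /predU1P[->|/fx].
  - by split=> // i ltim; apply: fx; rewrite ltnW.
  - exact: fx.
apply: locally_closed_eq0 (IHm lcX).
by apply: sub_fraction (ff m) => x [].
Qed.

(** * Polynomials whose coefficients are fractions *)

Section Families.
Variables (n : nat) (X : aset L n).
Implicit Types p q : 'rV[L]_n -> {poly L}.

Definition poly_fraction p : Prop := forall i, fraction X (fun x => (p x)`_i).

Lemma eq_poly_fraction p q :
  (forall x, X x -> p x = q x) -> poly_fraction p -> poly_fraction q.
Proof. by move=> pq fp i; apply: eq_fraction (fp i) => x Xx; rewrite pq. Qed.

Lemma poly_fraction0 : poly_fraction (fun _ => 0).
Proof. by move=> i; apply: eq_fraction (fraction0 X) => x _; rewrite coef0. Qed.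

Lemma poly_fractionXn m : poly_fraction (fun _ => 'X^m).
Proof.
move=> i; case: (altP (i =P m)) => [->|im].
  by apply: eq_fraction (fraction1 X) => x _; rewrite coefXn eqxx.
by apply: eq_fraction (fraction0 X) => x _; rewrite coefXn (negPf im).
Qed.

Lemma poly_fractionD p q :
  poly_fraction p -> poly_fraction q -> poly_fraction (fun x => p x + q x).
Proof.
move=> fp fq i; apply: eq_fraction (fractionD (fp i) (fq i)) => x _.
by rewrite coefD.
Qed.

Lemma poly_fractionN p : poly_fraction p -> poly_fraction (fun x => - p x).
Proof.
by move=> fp i; apply: eq_fraction (fractionN (fp i)) => x _; rewrite coefN.
Qed.

Lemma poly_fractionZ f p :
  fraction X f -> poly_fraction p -> poly_fraction (fun x => f x *: p x).
Proof.
move=> ff fp i; apply: eq_fraction (fractionM ff (fp i)) => x _.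
by rewrite coefZ.
Qed.

Lemma poly_fractionM p q :
  poly_fraction p -> poly_fraction q -> poly_fraction (fun x => p x * q x).
Proof.
move=> fp fq i.
apply: (@eq_fraction _ _ (fun x => \sum_(j < i.+1) (p x)`_j * (q x)`_(i - j))).
  by move=> x _; rewrite coefM.
by apply: fraction_sum => j; apply: fractionM.
Qed.

Lemma poly_fraction_poly m (f : nat -> 'rV[L]_n -> L) :
  (forall i, fraction X (f i)) -> poly_fraction (fun x => \poly_(i < m) f i x).
Proof.
move=> ff i; case: (ltnP i m) => im.
  by apply: eq_fraction (ff i) => x _; rewrite coef_poly im.
by apply: eq_fraction (fraction0 X) => x _; rewrite coef_poly ltnNge im.
Qed.

Lemma poly_fraction_monic_of m (a : 'rV[L]_n -> 'rV[L]_m) :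
    (forall i, fraction X (fun x => a x 0 i)) ->
  poly_fraction (fun x => monic_of (a x)).
Proof.
move=> fa; apply: poly_fractionD; first exact: poly_fractionXn.
move=> i; apply: (@eq_fraction _ _
    (fun x => \sum_(j < m) (a x 0 j *: 'X^(m - j.+1) : {poly L})`_i)).
  by move=> x _; rewrite coef_sum.
by apply: fraction_sum => j; apply: poly_fractionZ => //; apply: poly_fractionXn.
Qed.

Lemma fraction_coords m p j :
  poly_fraction p -> fraction X (fun x => coords m (p x) 0 j).
Proof.
by move=> fp; apply: eq_fraction (fp (m - j.+1)%N) => x _; rewrite mxE.
Qed.

(** Each step of the long division by a monic polynomial uses only ring
    operations.  The uniform bound m on the degree makes the number of steps the
    same at all points of X. *)
Lemma poly_fraction_divmod m e p q :
    (forall x, X x -> (size (p x) <= m)%N) ->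
    (forall x, X x -> q x \is monic /\ size (q x) = e.+1) ->
    poly_fraction p -> poly_fraction q ->
  poly_fraction (fun x => p x %/ q x) /\ poly_fraction (fun x => p x %% q x).
Proof.
move=> + mq + fq; elim: m p => [|m IHm] p sp fp.
  have p0 x : X x -> p x = 0.
    by move/sp; rewrite leqn0 size_poly_eq0 => /eqP.
  by split; apply: eq_poly_fraction poly_fraction0 => x /p0->; rewrite ?div0p ?mod0p.
case: (ltnP m e) => [lt_me|le_em].
  have lt_pq x : X x -> (size (p x) < size (q x))%N.
    move=> Xx; have [_ ->] := mq x Xx.
    by rewrite ltnS; apply: leq_trans (sp x Xx) lt_me.
  split; [apply: eq_poly_fraction poly_fraction0|apply: eq_poly_fraction fp] => x Xx.
    by rewrite divp_small // lt_pq.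
  by rewrite modp_small // lt_pq.
(* The top term of the quotient: subtracting c * q kills the coefficient of 'X^m. *)
pose c x : {poly L} := (p x)`_m *: 'X^(m - e).
have fc : poly_fraction c by apply: poly_fractionZ => //; apply: poly_fractionXn.
pose p' x := p x - c x * q x.
have fp' : poly_fraction p'.
  by apply: poly_fractionD => //; apply: poly_fractionN; apply: poly_fractionM.
have sp' x : X x -> (size (p' x) <= m)%N.
  move=> Xx; have [qm sq] := mq x Xx; apply/leq_sizeP => i le_mi.
  rewrite coefB -scalerAl coefZ coefXnM ltnNge (leq_trans (leq_subr _ _) le_mi) /=.
  move: le_mi; rewrite leq_eqVlt => /predU1P[<-|lt_mi].
    rewrite subKn // (_ : (q x)`_e = 1) ?mulr1 ?subrr //.
    by move/monicP: qm; rewrite lead_coefE sq.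
  rewrite [(p x)`_i]nth_default ?(leq_trans (sp x Xx)) //.
  by rewrite [(q x)`__]nth_default ?mulr0 ?subr0 // sq ltn_subRL subnK //.
have [fdiv fmod] := IHm p' sp' fp'.
have pE x : p x = c x * q x + p' x by rewrite /p' addrC subrK.
split.
  apply: eq_poly_fraction (poly_fractionD fc fdiv) => x Xx.
  have [qm _] := mq x Xx.
  by rewrite [in RHS]pE divp_addl_mul // monic_neq0.
apply: eq_poly_fraction fmod => x Xx.
by rewrite [in RHS]pE [RHS]modpD modp_mull add0r.
Qed.

End Families.
End Fractions.

(** * Remainder degrees in Euclid's algorithm *)

Section Euclid.
Variable F : fieldType.
Implicit Types (p q g : {poly F}) (s : seq nat).

Definition monic_scale p : {poly F} := (lead_coef p)^-1 *: p.

Lemma monic_scale_monic p : p != 0 -> monic_scale p \is monic.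
Proof. by move=> p0; rewrite monicE lead_coefZ mulVf // lead_coef_eq0. Qed.

Lemma size_monic_scale p : size (monic_scale p) = size p.
Proof.
have [->|p0] := eqVneq p 0; first by rewrite /monic_scale scaler0.
by rewrite size_scale // invr_eq0 lead_coef_eq0.
Qed.

Lemma monic_scale_eqp p : monic_scale p %= p.
Proof.
have [->|p0] := eqVneq p 0; first by rewrite /monic_scale scaler0 eqpxx.
by apply: eqp_scale; rewrite invr_eq0 lead_coef_eq0.
Qed.

Lemma monic_scale_id p : p \is monic -> monic_scale p = p.
Proof. by rewrite /monic_scale => /monicP->; rewrite invr1 scale1r. Qed.

Lemma eq_monic_scale p q : p %= q -> monic_scale p = monic_scale q.
Proof.
move=> pq; have [q0|q0] := eqVneq q 0.
  by move: pq; rewrite q0 eqp0 => /eqP->.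
have p0 : p != 0 by rewrite -size_poly_gt0 (eqp_size pq) size_poly_gt0.
apply/eqP; rewrite -eqp_monic ?monic_scale_monic //.
apply: eqp_trans (monic_scale_eqp p) (eqp_trans pq _).
by rewrite eqp_sym monic_scale_eqp.
Qed.

Lemma monic_scaleM p g :
  g \is monic -> monic_scale (p * g) = monic_scale p * g.
Proof. by move=> gm; rewrite /monic_scale lead_coef_Mmonic // scalerAl. Qed.

(** The sequence s lists the degrees of the nonzero remainders, each of which is
    made monic before the next division.  Normalising keeps all divisors
    monic, and separates the unit factors, which give the G_m coordinates. *)
Fixpoint euclid s p q : bool :=
  if s is j :: s' then
    (size (p %% q)%R == j.+1) && euclid s' q (monic_scale (p %% q)%R)
  else q %| p.

(** [gcdp] is only determined up to a unit; families need the monic gcd. *)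
Definition mgcd p q : {poly F} := monic_scale (gcdp p q).

Lemma rem_neq0 p q j : size (p %% q) == j.+1 -> p %% q != 0.
Proof. by rewrite -size_poly_eq0 => /eqP->. Qed.

Lemma gcdp_rem p q : gcdp p q %= gcdp q (monic_scale (p %% q)).
Proof.
apply: eqp_trans (gcdpC p q) _.
rewrite eqp_sym; apply: eqp_trans (gcdp_modr q p).
exact: eqp_gcdr (monic_scale_eqp _).
Qed.

Lemma euclid_inj s s' p q : euclid s p q -> euclid s' p q -> s = s'.
Proof.
elim: s s' p q => [|j s IHs] [|j' s'] p q //=.
- by move=> /modp_eq0P->; rewrite size_poly0.
- by move=> /andP[sr _] /modp_eq0P r0; rewrite r0 size_poly0 in sr.
by case/andP=> /eqP-> es /andP[/eqP[<-]] /(IHs _ _ _ es)->.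
Qed.

Lemma euclid_path s p q : q != 0 -> euclid s p q -> path gtn (size q).-1 s.
Proof.
elim: s p q => //= j s IHs p q q0 /andP[sr es].
have /(IHs _ _) /(_ es) : monic_scale (p %% q) != 0.
  by rewrite monic_neq0 ?monic_scale_monic ?(rem_neq0 sr).
rewrite size_monic_scale (eqP sr) /= => ->; rewrite andbT.
by rewrite -ltnS -(eqP sr) prednK ?size_poly_gt0 // ltn_modp.
Qed.

Lemma euclid_exists p q : q != 0 -> exists s, euclid s p q.
Proof.
have [n] := ubnP (size q); elim: n p q => // n IHn p q; rewrite ltnS => sq q0.
have [r0|r0] := eqVneq (p %% q) 0; first by exists [::]; apply/modp_eq0P.
have [||s es] := IHn q (monic_scale (p %% q)).
- by rewrite size_monic_scale; apply: leq_trans sq; rewrite ltn_modp.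
- by rewrite monic_neq0 ?monic_scale_monic.
by exists ((size (p %% q)).-1 :: s); rewrite /= es prednK ?size_poly_gt0 ?eqxx.
Qed.

Lemma size_gcdp_euclid s p q :
  q != 0 -> euclid s p q -> size (gcdp p q) = (last (size q).-1 s).+1.
Proof.
elim: s p q => [|j s IHs] p q q0 /= => [qp|/andP[sr es]].
  rewrite prednK ?size_poly_gt0 //; apply: eqp_size.
  by rewrite /eqp dvdp_gcdr dvdp_gcd qp dvdpp.
rewrite (eqp_size (gcdp_rem p q)) IHs // ?size_monic_scale ?(eqP sr) //.
by rewrite monic_neq0 ?monic_scale_monic ?(rem_neq0 sr).
Qed.

Lemma modpM2r p q g : q != 0 -> g != 0 -> (p * g) %% (q * g) = (p %% q) * g.
Proof.
move=> q0 g0; apply/esym/(@modpP _ _ (p %/ q)).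
  by rewrite mulrA -mulrDl -divp_eq.
by have [->|r0] := eqVneq (p %% q) 0;
   rewrite ?mul0r ?size_poly0 ?size_poly_gt0 ?mulf_neq0 // !size_mul //
     -!subn1 ltn_sub2r ?ltn_add2r ?ltn_modp // -addn1 leq_add ?size_poly_gt0.
Qed.

(** All the remainders get multiplied by g, so their degrees go up by deg g. *)
Lemma euclidM k s p q g : g \is monic -> size g = k.+1 -> q != 0 ->
  euclid (map (addn k) s) (p * g) (q * g) = euclid s p q.
Proof.
move=> gm sg; have g0 := monic_neq0 gm.
elim: s p q => [|j s IHs] p q q0 /=; first by rewrite dvdp_mul2r.
rewrite modpM2r // monic_scaleM //.
have [->|r0] := eqVneq (p %% q) 0; first by rewrite mul0r size_poly0.
rewrite size_Mmonic // sg addnS /= addnC -addnS eqn_add2l.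
by rewrite IHs // monic_neq0 ?monic_scale_monic.
Qed.

Lemma mgcd_monic p q : q != 0 -> mgcd p q \is monic.
Proof. by move=> q0; apply: monic_scale_monic; rewrite gcdp_eq0 negb_and q0 orbT. Qed.

Lemma size_mgcd p q : size (mgcd p q) = size (gcdp p q).
Proof. exact: size_monic_scale. Qed.

Lemma mgcd_dvdl p q : mgcd p q %| p.
Proof. by rewrite (eqp_dvdl _ (monic_scale_eqp _)) dvdp_gcdl. Qed.

Lemma mgcd_dvdr p q : mgcd p q %| q.
Proof. by rewrite (eqp_dvdl _ (monic_scale_eqp _)) dvdp_gcdr. Qed.

Lemma mgcdC p q : mgcd p q = mgcd q p.
Proof. exact: eq_monic_scale (gcdpC p q). Qed.

Lemma mgcd_rem p q : mgcd p q = mgcd q (monic_scale (p %% q)).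
Proof. exact: eq_monic_scale (gcdp_rem p q). Qed.

Lemma mgcd_dvd p q : q \is monic -> q %| p -> mgcd p q = q.
Proof.
move=> qm qp; rewrite -[RHS]monic_scale_id //; apply: eq_monic_scale.
by rewrite /eqp dvdp_gcdr dvdp_gcd qp dvdpp.
Qed.

Lemma mgcdM p q g : g \is monic -> mgcd (p * g) (q * g) = mgcd p q * g.
Proof.
by move=> gm; rewrite -monic_scaleM //; apply/eq_monic_scale/gcdp_mul2r.
Qed.

Lemma mgcd_coprime p q : coprimep p q -> mgcd p q = 1.
Proof.
rewrite -gcdp_eqp1 => /eq_monic_scale; rewrite /mgcd => ->.
exact/monic_scale_id/monic1.
Qed.

(** * Coordinates on a stratum of coprime pairs *)

(** The quotient of a division step from degree d to degree e takes its
    coefficients from the entries e, ..., d - 1 of u.  Successive steps go down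
    through consecutive intervals, so the whole algorithm reads each of the d
    first entries of u exactly once. *)
Definition quot_of (d e : nat) (u : nat -> F) : {poly F} :=
  'X^(d - e) + \poly_(i < d - e) u (e + i)%N.

Lemma quot_of_monic d e u :
  quot_of d e u \is monic /\ size (quot_of d e u) = (d - e).+1.
Proof.
have lt_s : (size (\poly_(i < d - e) u (e + i)%N) < size ('X^(d - e) : {poly F}))%N.
  by rewrite size_polyXn ltnS size_poly.
split; last by rewrite size_polyDl // size_polyXn.
by rewrite monicE lead_coefDl // lead_coefXn.
Qed.

(** Euclid's algorithm run backwards, from the gcd 1.  The leading coefficients
    are indexed by the number of steps that remain, so that no shift of t is
    needed in the recursion. *)
Fixpoint decode s d e (u t : nat -> F) : {poly F} * {poly F} :=
  if s is j :: s' then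
    let qr := decode s' e j u t in
    (quot_of d e u * qr.1 + t (size s') *: qr.2, qr.1)
  else (quot_of d e u, 1).

Fixpoint encode_quot s d e p q (i : nat) : F :=
  if (e <= i)%N then (p %/ q)`_(i - e)
  else if s is j :: s' then encode_quot s' e j q (monic_scale (p %% q)) i else 0.

Fixpoint encode_lead s p q (i : nat) : F :=
  if s is j :: s' then
    if i == size s' then (p %% q)`_j
    else encode_lead s' q (monic_scale (p %% q)) i
  else 0.

(** The reconstructed divisions have the prescribed quotient and remainder by
    uniqueness, the degrees decreasing along s; last e s = 0 says that the gcd
    is constant. *)
Lemma decodeP s d e u t : (e <= d)%N -> path gtn e s -> last e s = 0 ->
    (forall i, (i < size s)%N -> t i != 0) ->
  let pq := decode s d e u t in
  [/\ [/\ pq.1 \is monic, size pq.1 = d.+1, pq.2 \is monic & size pq.2 = e.+1],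
      euclid s pq.1 pq.2,
      forall i, (i < d)%N -> encode_quot s d e pq.1 pq.2 i = u i
    & forall i, (i < size s)%N -> encode_lead s pq.1 pq.2 i = t i].
Proof.
elim: s d e => [|j s IHs] d e /= led.
  move=> _ e0 _; rewrite e0; have [qm sq] := quot_of_monic d 0 u.
  rewrite sq subn0 monic1 size_poly1 dvd1p; split=> // i id.
  rewrite leq0n divp1 subn0 coefD coefXn coef_poly subn0 id.
  by rewrite (ltn_eqF id) add0r add0n.
move=> /andP[lt_je pth] lst tn.
have [] := IHs e j (ltnW lt_je) pth lst.
  by move=> i lt_i; apply: tn; rewrite ltnW.
set q := (decode s e j u t).1; set r := (decode s e j u t).2.
move=> [qm sq rm sr] er eq_ el; set m := quot_of d e u; set c := t (size s).
have [mm sm] := quot_of_monic d e u.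
have c0 : c != 0 by exact: tn.
have scr : size (c *: r) = j.+1 by rewrite size_scale.
have lt_cr : (size (c *: r) < size q)%N by rewrite scr sq ltnS.
have modE : (m * q + c *: r) %% q = c *: r by rewrite modp_addl_mul_small.
have divE : (m * q + c *: r) %/ q = m by rewrite divp_addl_mul_small.
have scE : monic_scale (c *: r) = r.
  by rewrite -[RHS]monic_scale_id //; apply/eq_monic_scale/eqp_scale.
have smq : size (m * q) = d.+1.
  by rewrite size_Mmonic ?monic_neq0 // sm sq addnS /= addSn subnK.
rewrite /= modE divE scE scr eqxx; split=> //.
- split=> //; last by rewrite size_polyDl // smq scr !ltnS (leq_trans lt_je).
  rewrite monicE lead_coefDl ?smq ?scr ?ltnS ?(leq_trans lt_je) //.
  by rewrite lead_coef_Mmonic //; apply/monicP.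
- move=> i id; case: ltnP => [lt_ie|le_ei]; last first.
    have lt_ie : (i - e < d - e)%N by rewrite ltn_sub2r // (leq_ltn_trans le_ei).
    by rewrite coefD coefXn coef_poly lt_ie subnKC // (ltn_eqF lt_ie) add0r.
  exact: eq_.
move=> i; rewrite ltnS leq_eqVlt => /predU1P[->|lt_i]; last by rewrite ltn_eqF ?el.
by rewrite eqxx coefZ (_ : r`_j = 1) ?mulr1 //; move/monicP: rm; rewrite lead_coefE sr.
Qed.

Lemma encode_lead_neq0 s p q i :
  euclid s p q -> (i < size s)%N -> encode_lead s p q i != 0.
Proof.
elim: s p q => //= j s IHs p q /andP[sr es] lt_i.
case: (eqVneq i (size s)) => [_|ni]; last by rewrite IHs // ltn_neqAle ni -ltnS.
have := rem_neq0 sr; rewrite -lead_coef_eq0 lead_coefE (eqP sr); exact.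
Qed.

(** The streams u and t need only agree with the coordinates on the entries that
    are read; this allows them to come from vectors of finite length. *)
Lemma encodeK s d e p q u t : (e <= d)%N -> path gtn e s -> last e s = 0 ->
    p \is monic -> size p = d.+1 -> q \is monic -> size q = e.+1 ->
    euclid s p q ->
    (forall i, (i < d)%N -> u i = encode_quot s d e p q i) ->
    (forall i, (i < size s)%N -> t i = encode_lead s p q i) ->
  decode s d e u t = (p, q).
Proof.
elim: s d e p q => [|j s IHs] d e p q /= led.
  move=> _ e0 pm sp qm sq _ uE _; rewrite e0 in led uE sq *.
  have q1 : q = 1.
    have /eqP := sq; rewrite size_poly_eq1 eqp_monic ?monic1 //; exact/eqP.
  rewrite q1 /quot_of subn0 in uE *; congr (_, _); apply/polyP => i.
  rewrite coefD coefXn coef_poly; case: ltngtP => [lt_id|lt_di|->].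
  - by rewrite add0r add0n uE //= divp1 subn0.
  - by rewrite addr0 nth_default // sp.
  by rewrite addr0; move/monicP: pm; rewrite lead_coefE sp.
move=> /andP[lt_je pth] lst pm sp qm sq /andP[sr es] uE tE.
have r0 := rem_neq0 sr; set r := monic_scale (p %% q) in es uE tE.
have -> : decode s e j u t = (q, r).
  apply: (IHs _ _ _ _ (ltnW lt_je)) => //.
  - exact: monic_scale_monic.
  - by rewrite size_monic_scale (eqP sr).
  - by move=> i ie; rewrite uE ?(leq_trans ie) // leqNgt ie.
  by move=> i lt_i; rewrite tE 1?ltnW // ltn_eqF.
have -> : t (size s) *: r = p %% q.
  rewrite tE // eqxx /r /monic_scale lead_coefE (eqP sr) scalerA mulfV ?scale1r //.
  by have := r0; rewrite -lead_coef_eq0 lead_coefE (eqP sr).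
suff -> : quot_of d e u = p %/ q by rewrite /= -divp_eq.
have sd : size (p %/ q) = (d - e).+1.
  by rewrite size_divp ?monic_neq0 // sp sq /= subSn.
have dm : p %/ q \is monic.
  have := pm; rewrite monicE {1}(divp_eq p q) lead_coefDl.
    by rewrite lead_coef_Mmonic.
  rewrite size_Mmonic //; last by rewrite -size_poly_gt0 sd.
  rewrite sd sq addnS /= addSn subnK //.
  by rewrite (eqP sr) !ltnS (leq_trans lt_je).
apply/polyP => i; rewrite coefD coefXn coef_poly; case: ltngtP => [lt_i|lt_i|->].
- by rewrite add0r uE ?leq_addr ?addKn // -ltn_subRL.
- by rewrite addr0 nth_default // sd.
by rewrite addr0; move/monicP: dm; rewrite lead_coefE sd.
Qed.

End Euclid.

(** * Euclid's algorithm in families *)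

Section EuclidFamilies.
Variables (K : fieldType) (L : closedFieldType) (iota : {rmorphism K -> L}).
Variable n : nat.
Implicit Types (X : aset L n) (p q : 'rV[L]_n -> {poly L}) (s : seq nat).

Definition monic_family X (e : nat) p : Prop :=
  poly_fraction iota X p /\ forall x, X x -> p x \is monic /\ size (p x) = e.+1.

Lemma sub_monic_family X Y e p :
  asubset X Y -> monic_family Y e p -> monic_family X e p.
Proof.
move=> XY [fp mp]; split=> [i|x /XY/mp //].
exact: sub_fraction XY (fp i).
Qed.

Lemma monic_family_divmod X d e p q :
    monic_family X d p -> monic_family X e q ->
  poly_fraction iota X (fun x => p x %/ q x)
  /\ poly_fraction iota X (fun x => p x %% q x).
Proof.
move=> [fp mp] [fq mq]; apply: (@poly_fraction_divmod _ _ _ _ _ d.+1 e) => //.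
by move=> x /mp[_ ->].
Qed.

(** This is where fixing the degree of the remainder matters: its leading
    coefficient is then one fixed coefficient, nonzero on all of X. *)
Lemma monic_family_rem X d e p q j :
    monic_family X d p -> monic_family X e q ->
    (forall x, X x -> size (p x %% q x) == j.+1) ->
  monic_family X j (fun x => monic_scale (p x %% q x)).
Proof.
move=> mp mq sr; have [_ fr] := monic_family_divmod mp mq.
split=> [|x Xx]; last first.
  by rewrite size_monic_scale (eqP (sr x Xx)) monic_scale_monic ?(rem_neq0 (sr x Xx)).
apply: poly_fractionZ => //.
apply: (@eq_fraction _ _ _ _ _ (fun x => ((p x %% q x)`_j)^-1)).
  by move=> x Xx; rewrite lead_coefE (eqP (sr x Xx)).
apply: fractionV => [x Xx|]; last exact: fr.
by have := rem_neq0 (sr x Xx); rewrite -lead_coef_eq0 lead_coefE (eqP (sr x Xx)).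
Qed.

(** A remainder of degree j means that its coefficients of index above j vanish
    while the one of index j does not; on the resulting locally closed set the
    normalised remainder is again a monic family. *)
Lemma locally_closed_euclid s X d e p q :
    monic_family X d p -> monic_family X e q -> locally_closed iota X ->
  locally_closed iota (fun x => X x /\ euclid s (p x) (q x)).
Proof.
elim: s X d e p q => [|j s IHs] X d e p q mp mq lcX /=.
  have [_ fr] := monic_family_divmod mp mq.
  apply: eq_locally_closed (@locally_closed_all_eq0 _ _ _ _ _ e _ fr lcX) => x.
  split=> [][Xx H]; split=> //; last by move=> i _; rewrite (modp_eq0P _ _ H) coef0.
  apply/modp_eq0P/polyP => i; rewrite coef0; case: (ltnP i e) => [/H//|le_ei].
  have [/monic_neq0 q0 sq] := mq.2 x Xx.
  by rewrite nth_default // (leq_trans _ le_ei) // -ltnS -sq ltn_modp.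
pose r x := p x %% q x.
have [_ fr] : _ /\ poly_fraction iota X r := monic_family_divmod mp mq.
pose X1 x := X x /\ forall i, (i < e)%N -> (r x)`_(j.+1 + i) = 0.
pose X2 x := X1 x /\ (r x)`_j != 0.
have lc2 : locally_closed iota X2.
  apply: locally_closed_neq0; first by apply: sub_fraction (fr j) => x [].
  by apply: (locally_closed_all_eq0 _ (fun i => fr _)).
have X2E x : X2 x <-> X x /\ size (r x) == j.+1.
  split=> [[[Xx rx0] rxj]|[Xx /eqP sr]]; last first.
    split; first by split=> // i _; rewrite nth_default // sr leq_addr.
    by have := @rem_neq0 _ (p x) (q x) j; rewrite -lead_coef_eq0 lead_coefE sr; apply.
  split=> //; rewrite eqn_leq; apply/andP; split; last first.
    by rewrite ltnNge; apply: contra rxj => sr; rewrite nth_default.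
  apply/leq_sizeP => i lt_ji; case: (ltnP i e) => [lt_ie|le_ei].
    by rewrite -(subnKC lt_ji) rx0 // (leq_ltn_trans (leq_subr _ _)).
  have [/monic_neq0 q0 sq] := mq.2 x Xx.
  by rewrite nth_default // (leq_trans _ le_ei) // -ltnS -sq ltn_modp.
have sub2 : asubset X2 X by move=> x [[]].
have mr : monic_family X2 j (fun x => monic_scale (r x)).
  apply: monic_family_rem (sub_monic_family sub2 mp) (sub_monic_family sub2 mq) _.
  by move=> x /X2E[].
apply: eq_locally_closed (IHs _ _ _ _ _ (sub_monic_family sub2 mq) mr lc2) => x.
split=> [[/X2E[Xx sr] es]|[Xx /andP[sr es]]]; first by rewrite -/(r x) sr.
by split=> //; apply/X2E.
Qed.

(** The gcd is the last divisor, reached after the same number of divisions at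
    all points of X. *)
Lemma poly_fraction_mgcd s X d e p q :
    monic_family X d p -> monic_family X e q ->
    (forall x, X x -> euclid s (p x) (q x)) ->
  poly_fraction iota X (fun x => mgcd (p x) (q x)).
Proof.
elim: s d e p q => [|j s IHs] d e p q mp mq es.
  apply: eq_poly_fraction mq.1 => x Xx; have [qm _] := mq.2 x Xx.
  by rewrite mgcd_dvd //; apply: es.
have es' x Xx := andP (es x Xx).
apply: (@eq_poly_fraction _ _ _ _ _ (fun x => mgcd (q x) (monic_scale (p x %% q x)))).
  by move=> x _; rewrite -mgcd_rem.
apply: IHs mq (monic_family_rem mp mq (fun x Xx => (es' x Xx).1)) _.
by move=> x /es'[].
Qed.

Lemma fraction_encode_quot s X d e p q i :
    monic_family X d p -> monic_family X e q ->
    (forall x, X x -> euclid s (p x) (q x)) ->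
  fraction iota X (fun x => encode_quot s d e (p x) (q x) i).
Proof.
elim: s d e p q => [|j s IHs] d e p q mp mq es /=;
  case: (e <= i)%N; try exact: (monic_family_divmod mp mq).1.
  exact: fraction0.
have es' x Xx := andP (es x Xx).
apply: IHs mq (monic_family_rem mp mq (fun x Xx => (es' x Xx).1)) _.
by move=> x /es'[].
Qed.

Lemma fraction_encode_lead s X d e p q i :
    monic_family X d p -> monic_family X e q ->
    (forall x, X x -> euclid s (p x) (q x)) ->
  fraction iota X (fun x => encode_lead s (p x) (q x) i).
Proof.
elim: s d e p q => [|j s IHs] d e p q mp mq es /=; first exact: fraction0.
case: (i == size s); first exact: (monic_family_divmod mp mq).2.
have es' x Xx := andP (es x Xx).
apply: IHs mq (monic_family_rem mp mq (fun x Xx => (es' x Xx).1)) _.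
by move=> x /es'[].
Qed.

Lemma poly_fraction_decode s X d e (u t : 'rV[L]_n -> nat -> L) :
    (forall i, fraction iota X (fun x => u x i)) ->
    (forall i, fraction iota X (fun x => t x i)) ->
  poly_fraction iota X (fun x => (decode s d e (u x) (t x)).1)
  /\ poly_fraction iota X (fun x => (decode s d e (u x) (t x)).2).
Proof.
move=> fu ft.
have fq d' e' : poly_fraction iota X (fun x => quot_of d' e' (u x)).
  apply: poly_fractionD; first exact: poly_fractionXn.
  by apply: (poly_fraction_poly _ (fun i => fu _)).
elim: s d e => [|j s IHs] d e /=.
  by split=> //; apply: eq_poly_fraction (poly_fractionXn _ _ 0) => x _; rewrite expr0.
have [f1 f2] := IHs e j; split=> //.
by apply: poly_fractionD; [apply: poly_fractionM | apply: poly_fractionZ].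
Qed.

End EuclidFamilies.

(** * The finite set of degree sequences *)

Section Sequences.

Fixpoint decreasing_seqs (n : nat) : seq (seq nat) :=
  if n is m.+1 then decreasing_seqs m ++ [seq m :: s | s <- decreasing_seqs m]
  else [:: [::]].

Lemma mem_decreasing_seqs n s : path gtn n s -> s \in decreasing_seqs n.
Proof.
elim: n s => [|n IHn] [|j s] //=.
  by rewrite mem_cat IHn.
move=> /andP[]; rewrite ltnS leq_eqVlt mem_cat => /predU1P[->|lt_jn] pth.
  by rewrite map_f ?orbT ?IHn.
by rewrite IHn //= lt_jn.
Qed.

(** Remainder degrees of coprime pairs: they decrease, start below the degree n of
    the first divisor, and end with the degree 0 of the gcd. *)
Definition degree_seqs (n : nat) : seq (seq nat) :=
  undup [seq s <- decreasing_seqs n | path gtn n s && (last n s == 0)].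

Lemma mem_degree_seqs n s :
  (s \in degree_seqs n) = path gtn n s && (last n s == 0).
Proof.
rewrite mem_undup mem_filter andb_idr //.
by move=> /andP[/mem_decreasing_seqs].
Qed.

End Sequences.

(** * Strata of pairs of monic polynomials *)

Section Coordinates.
Variable L : fieldType.

Lemma monic_ofK m : cancel (@monic_of L m) (@coords L m).
Proof.
move=> a; apply/rowP => i; rewrite mxE coefD coefXn.
rewrite (ltn_eqF (_ : _ < m)%N) ?add0r; last first.
  by rewrite ltn_subrL (leq_ltn_trans _ (ltn_ord i)).
rewrite coef_sum (bigD1 i) //= coefZ coefXn eqxx mulr1 big1 ?addr0 // => j ji.
rewrite coefZ coefXn eqn_sub2lE // eqSS eq_sym (negPf (_ : val j != i)) ?mulr0 //.
Qed.

Section Pair.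
Variables d1 d2 : nat.

(** Euclid's algorithm starts by dividing the polynomial of larger degree.
    Dividing in the other order would produce a first remainder which is
    monic already, hence a leading coefficient that is not a free
    coordinate. *)
Definition major (v : 'rV[L]_(d1 + d2)) : {poly L} :=
  if (d2 <= d1)%N then monic_of (lsubmx v) else monic_of (rsubmx v).

Definition minor (v : 'rV[L]_(d1 + d2)) : {poly L} :=
  if (d2 <= d1)%N then monic_of (rsubmx v) else monic_of (lsubmx v).

Definition pair_coords (pq : {poly L} * {poly L}) : 'rV[L]_(d1 + d2) :=
  if (d2 <= d1)%N then row_mx (coords d1 pq.1) (coords d2 pq.2)
  else row_mx (coords d1 pq.2) (coords d2 pq.1).

Lemma major_monic v : major v \is monic /\ size (major v) = (maxn d1 d2).+1.
Proof. by rewrite /major; case: leqP => _; apply: monic_of_monic. Qed.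

Lemma minor_monic v : minor v \is monic /\ size (minor v) = (minn d1 d2).+1.
Proof. by rewrite /minor; case: leqP => _; apply: monic_of_monic. Qed.

Lemma pair_coordsK v : pair_coords (major v, minor v) = v.
Proof.
by rewrite /pair_coords /major /minor; case: leqP => _ /=; rewrite !monic_ofK hsubmxK.
Qed.

Lemma major_minor_pair_coords p q :
    p \is monic -> size p = (maxn d1 d2).+1 ->
    q \is monic -> size q = (minn d1 d2).+1 ->
  major (pair_coords (p, q)) = p /\ minor (pair_coords (p, q)) = q.
Proof.
rewrite /pair_coords /major /minor; case: leqP => _ pm sp qm sq;
  by rewrite row_mxKl row_mxKr !coordsK.
Qed.

Definition stratum s : aset L (d1 + d2) := fun v => euclid s (major v) (minor v).

Lemma mgcd_major_minor v :
  mgcd (major v) (minor v) = mgcd (monic_of (lsubmx v)) (monic_of (rsubmx v)).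
Proof. by rewrite /major /minor; case: ifP => // _; rewrite mgcdC. Qed.

Lemma size_mgcd_stratum s v : stratum s v ->
  size (mgcd (monic_of (lsubmx v)) (monic_of (rsubmx v)))
  = (last (minn d1 d2) s).+1.
Proof.
have [/monic_neq0 q0 sq] := minor_monic v.
by rewrite -mgcd_major_minor size_mgcd => /size_gcdp_euclid->; rewrite ?sq.
Qed.

Lemma Poly1E v :
  Poly1 L d1 d2 v <-> size (mgcd (monic_of (lsubmx v)) (monic_of (rsubmx v))) = 1.
Proof. by rewrite size_mgcd /Poly1 coprimep_def; split=> /eqP. Qed.

(** Along a stratum the gcd has the last degree of the sequence, so coprimality
    only depends on the sequence. *)
Lemma Poly1_strata v :
  Poly1 L d1 d2 v <-> exists2 s, s \in degree_seqs (minn d1 d2) & stratum s v.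
Proof.
rewrite Poly1E; split=> [sg|[s + sv]]; last first.
  by rewrite mem_degree_seqs (size_mgcd_stratum sv) => /andP[_ /eqP->].
have [/monic_neq0 q0 sq] := minor_monic v.
have [s sv] := euclid_exists (major v) q0; exists s => //.
rewrite mem_degree_seqs -eqSS -(size_mgcd_stratum sv) sg eqxx andbT.
by have := euclid_path q0 sv; rewrite sq.
Qed.

Lemma R1E l v :
  R1 L l d1 d2 v <-> (l < size (mgcd (monic_of (lsubmx v)) (monic_of (rsubmx v))))%N.
Proof.
rewrite size_mgcd; set p := monic_of (lsubmx v); set q := monic_of (rsubmx v).
have q0 : q != 0 by have [/monic_neq0] := monic_of_monic (rsubmx v).
split=> [[h [lh hp hq]]|lt_l]; last by exists (gcdp p q); rewrite dvdp_gcdl dvdp_gcdr.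
apply: leq_trans lh (dvdp_leq _ _); last by rewrite dvdp_gcd; apply/andP.
by rewrite gcdp_eq0 negb_and q0 orbT.
Qed.

End Pair.

(** * The inverse of the multiplication map *)

Section Multiplication.
Variables d1 d2 k : nat.
Hypothesis hk : (k <= minn d1 d2)%N.

Definition unmul (y : 'rV[L]_(d1 + d2)) : 'rV[L]_((d1 - k) + (d2 - k) + k) :=
  let F1 := monic_of (lsubmx y) in
  let F2 := monic_of (rsubmx y) in
  let g := mgcd F1 F2 in
  row_mx (row_mx (coords (d1 - k) (F1 %/ g)) (coords (d2 - k) (F2 %/ g)))
         (coords k g).

Lemma common_factorE (y : 'rV[L]_(d1 + d2)) :
  adiff (R1 L k d1 d2) (R1 L k.+1 d1 d2) y <->
  size (mgcd (monic_of (lsubmx y)) (monic_of (rsubmx y))) = k.+1.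
Proof.
rewrite /adiff !R1E; split=> [[lt1 /negP]|->]; last by rewrite ltnSn ltnn.
by rewrite -leqNgt => le2; apply/eqP; rewrite eqn_leq le2.
Qed.

Lemma mgcd_Psi v :
  mgcd (monic_of (lsubmx (Psi L d1 d2 k v))) (monic_of (rsubmx (Psi L d1 d2 k v)))
  = mgcd (monic_of (lsubmx (lsubmx v))) (monic_of (rsubmx (lsubmx v)))
    * monic_of (rsubmx v).
Proof.
have [-> ->] := PsiE v hk.
by rewrite mgcdM //; case: (monic_of_monic (rsubmx v)).
Qed.

Lemma Psi_common_factor v : aprod (Poly1 L (d1 - k) (d2 - k)) (affine L k) v ->
  adiff (R1 L k d1 d2) (R1 L k.+1 d1 d2) (Psi L d1 d2 k v).
Proof.
move=> [/mgcd_coprime f1 _]; apply/common_factorE.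
by rewrite mgcd_Psi f1 mul1r; case: (monic_of_monic (rsubmx v)).
Qed.

Lemma unmulK v : aprod (Poly1 L (d1 - k) (d2 - k)) (affine L k) v ->
  unmul (Psi L d1 d2 k v) = v.
Proof.
move=> [/mgcd_coprime f1 _]; rewrite /unmul mgcd_Psi f1 mul1r.
have [-> ->] := PsiE v hk.
have /monic_neq0 g0 : monic_of (rsubmx v) \is monic by case: (monic_of_monic (rsubmx v)).
by rewrite !mulpK // !monic_ofK !hsubmxK.
Qed.

Lemma Psi_unmul y : adiff (R1 L k d1 d2) (R1 L k.+1 d1 d2) y ->
  aprod (Poly1 L (d1 - k) (d2 - k)) (affine L k) (unmul y)
  /\ Psi L d1 d2 k (unmul y) = y.
Proof.
move=> /common_factorE; set F1 := monic_of (lsubmx y); set F2 := monic_of (rsubmx y).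
set g := mgcd F1 F2 => sg.
have [m1 s1] : _ /\ size F1 = _ := monic_of_monic (lsubmx y).
have [m2 s2] : _ /\ size F2 = _ := monic_of_monic (rsubmx y).
have gm : g \is monic by rewrite mgcd_monic // monic_neq0.
have g0 := monic_neq0 gm.
have div_monic d F : F \is monic -> size F = d.+1 -> g %| F -> (k <= d)%N ->
    F %/ g \is monic /\ size (F %/ g) = (d - k).+1.
  move=> mF sF gF le_kd; rewrite size_divp // sF sg subSn //; split=> //.
  by rewrite -(monicMr _ gm) divpK.
have /andP[k1 k2] : (k <= d1)%N && (k <= d2)%N by rewrite -leq_min.
have [md1 sd1] := div_monic _ _ m1 s1 (mgcd_dvdl _ _) k1.
have [md2 sd2] := div_monic _ _ m2 s2 (mgcd_dvdr _ _) k2.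
have PsiK : Psi L d1 d2 k (unmul y) = y.
  rewrite /Psi /unmul -/F1 -/F2 -/g !row_mxKl !row_mxKr !coordsK //.
  by rewrite !divpK ?mgcd_dvdl ?mgcd_dvdr // !monic_ofK hsubmxK.
split=> //; split=> //; apply/Poly1E.
have := mgcd_Psi (unmul y); rewrite PsiK -/F1 -/F2 -/g.
rewrite [rsubmx (unmul y)]row_mxKr coordsK // => /esym gE.
have -> : mgcd (monic_of (lsubmx (lsubmx (unmul y))))
            (monic_of (rsubmx (lsubmx (unmul y)))) = 1.
  by apply: (mulIf g0); rewrite gE mul1r.
by rewrite size_poly1.
Qed.

Lemma stratum_Psi s v :
  stratum (map (addn k) s) (Psi L d1 d2 k v) <-> stratum s (lsubmx v).
Proof.
rewrite /stratum; set g := monic_of (rsubmx v).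
have [gm sg] : g \is monic /\ size g = k.+1 := monic_of_monic _.
have -> : major (Psi L d1 d2 k v) = major (lsubmx v) * g.
  rewrite /major; have [-> ->] := PsiE v hk.
  have /andP[k1 k2] : (k <= d1)%N && (k <= d2)%N by rewrite -leq_min.
  by rewrite leq_subLR subnKC //; case: ifP.
have -> : minor (Psi L d1 d2 k v) = minor (lsubmx v) * g.
  rewrite /minor; have [-> ->] := PsiE v hk.
  have /andP[k1 k2] : (k <= d1)%N && (k <= d2)%N by rewrite -leq_min.
  by rewrite leq_subLR subnKC //; case: ifP.
by rewrite (euclidM _ _ gm sg) //; case: (minor_monic (lsubmx v)) => /monic_neq0.
Qed.

(** The points of the shifted stratum have a gcd of degree k, so they come
    from Psi, and shifting back identifies the stratum they come from. *)
Lemma image_stratum s y : s \in degree_seqs (minn (d1 - k) (d2 - k)) ->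
  aimage (Psi L d1 d2 k) (aprod (@stratum (d1 - k) (d2 - k) s) (affine L k)) y
  <-> stratum (map (addn k) s) y.
Proof.
move=> ss; split=> [[v [sv _] ->]|sy]; first exact/stratum_Psi.
have [|_ unmulE] := @Psi_unmul y.
  apply/common_factorE; rewrite (size_mgcd_stratum sy).
  move: ss; rewrite mem_degree_seqs => /andP[_ /eqP lst].
  rewrite -[minn d1 d2](subnKC hk) last_map subn_minl.
  by rewrite lst addn0.
by exists (unmul y); rewrite ?unmulE //; split=> //; apply/stratum_Psi; rewrite unmulE.
Qed.

End Multiplication.
End Coordinates.

(** * Strata are products of lines and tori, and Psi is invertible on each *)

Section Strata.
Variables (K : fieldType) (L : closedFieldType) (iota : {rmorphism K -> L}).

Lemma fraction_row_mx n m1 m2 (X : aset L n) (a : 'rV[L]_n -> 'rV[L]_m1)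
    (b : 'rV[L]_n -> 'rV[L]_m2) :
    (forall i, fraction iota X (fun x => a x 0 i)) ->
    (forall i, fraction iota X (fun x => b x 0 i)) ->
  forall j, fraction iota X (fun x => row_mx (a x) (b x) 0 j).
Proof.
move=> fa fb j; have := splitK j; case: (split j) => i /= <-.
  by apply: eq_fraction (fa i) => x _; rewrite row_mxEl.
by apply: eq_fraction (fb i) => x _; rewrite row_mxEr.
Qed.

Lemma poly_fraction_lsub n m (X : aset L (n + m)) :
  poly_fraction iota X (fun v => monic_of (lsubmx v)).
Proof.
apply: poly_fraction_monic_of => i.
by apply: eq_fraction (fraction_coord _ _ (lshift m i)) => x _; rewrite mxE.
Qed.

Lemma poly_fraction_rsub n m (X : aset L (n + m)) :
  poly_fraction iota X (fun v => monic_of (rsubmx v)).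
Proof.
apply: poly_fraction_monic_of => i.
by apply: eq_fraction (fraction_coord _ _ (rshift n i)) => x _; rewrite mxE.
Qed.

Section Degrees.
Variables d1 d2 : nat.

Lemma monic_family_major (X : aset L (d1 + d2)) :
  monic_family iota X (maxn d1 d2) (@major L d1 d2).
Proof.
split=> [|x _]; last exact: major_monic.
rewrite /major; case: (d2 <= d1)%N; first exact: poly_fraction_lsub.
exact: poly_fraction_rsub.
Qed.

Lemma monic_family_minor (X : aset L (d1 + d2)) :
  monic_family iota X (minn d1 d2) (@minor L d1 d2).
Proof.
split=> [|x _]; last exact: minor_monic.
rewrite /minor; case: (d2 <= d1)%N; first exact: poly_fraction_rsub.
exact: poly_fraction_lsub.
Qed.

Lemma locally_closed_stratum s : locally_closed iota (@stratum L d1 d2 s).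
Proof.
pose A := affine L (d1 + d2).
apply: eq_locally_closed (locally_closed_euclid s (monic_family_major A)
  (monic_family_minor A) (locally_closed_affine iota _)) => v.
by split=> [[]|].
Qed.

(** [rVpoly] turns a row vector into the stream of its entries extended by 0;
    the added zeros are never read by [decode]. *)
Lemma stratum_torus s : s \in degree_seqs (minn d1 d2) ->
  isomorphic iota (@stratum L d1 d2 s) (affine_torus L (maxn d1 d2) (size s)).
Proof.
rewrite mem_degree_seqs => /andP[pth /eqP lst].
set d := maxn d1 d2; set e := minn d1 d2 in pth lst *.
have led : (e <= d)%N by apply: leq_trans (geq_minl _ _) (leq_maxl _ _).
pose f (v : 'rV[L]_(d1 + d2)) : 'rV[L]_(d + size s) :=
  row_mx (\row_(i < d) encode_quot s d e (major v) (minor v) i)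
         (\row_(i < size s) encode_lead s (major v) (minor v) i).
pose u (w : 'rV[L]_(d + size s)) i := (rVpoly (lsubmx w))`_i.
pose t (w : 'rV[L]_(d + size s)) i := (rVpoly (rsubmx w))`_i.
pose g w := pair_coords d1 d2 (decode s d e (u w) (t w)).
have tn w : affine_torus L d (size s) w -> forall i, (i < size s)%N -> t w i != 0.
  move=> Tw i lt_i; rewrite /t -[i]/(val (Ordinal lt_i)) coef_rVpoly_ord mxE.
  exact: Tw.
have decP w : affine_torus L d (size s) w ->
    let pq := decode s d e (u w) (t w) in
    [/\ major (g w) = pq.1, minor (g w) = pq.2 & stratum s (g w)].
  move=> /tn tw; have [[pm sp qm sq] es _ _] := decodeP (u w) led pth lst tw.
  have [] := major_minor_pair_coords pm sp qm sq; rewrite -surjective_pairing -/(g w).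
  by rewrite /stratum => -> ->.
have fu X i : fraction iota X (fun w => u w i).
  rewrite /u; case: (ltnP i d) => [lt_i|le_i].
    apply: eq_fraction (fraction_coord _ _ (lshift _ (Ordinal lt_i))) => w _.
    by rewrite -[i in RHS]/(val (Ordinal lt_i)) coef_rVpoly_ord mxE.
  apply: eq_fraction (fraction0 _ _) => w _.
  by rewrite nth_default // (leq_trans (size_poly _ _)).
have ft X i : fraction iota X (fun w => t w i).
  rewrite /t; case: (ltnP i (size s)) => [lt_i|le_i].
    apply: eq_fraction (fraction_coord _ _ (rshift _ (Ordinal lt_i))) => w _.
    by rewrite -[i in RHS]/(val (Ordinal lt_i)) coef_rVpoly_ord mxE.
  apply: eq_fraction (fraction0 _ _) => w _.
  by rewrite nth_default // (leq_trans (size_poly _ _)).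
exists f; split; [|exists g; split].
- apply: morphism_fraction => [v sv j|].
    by rewrite row_mxEr mxE encode_lead_neq0.
  apply: fraction_row_mx => i.
    apply: eq_fraction (fraction_encode_quot i (monic_family_major _)
      (monic_family_minor _) (fun v sv => sv)) => v _.
    by rewrite mxE.
  apply: eq_fraction (fraction_encode_lead i (monic_family_major _)
    (monic_family_minor _) (fun v sv => sv)) => v _.
  by rewrite mxE.
- apply: morphism_fraction => [w /decP[] //|].
  have [fp fq] := poly_fraction_decode s d e (fu (affine_torus L d (size s))) (ft _).
  rewrite /g /pair_coords; case: (d2 <= d1)%N; apply: fraction_row_mx => i;
    exact: fraction_coords.
- move=> v sv; rewrite /g.
  have [pm sp] := major_monic v; have [qm sq] := minor_monic v.
  rewrite (encodeK led pth lst pm sp qm sq sv) ?pair_coordsK // => i lt_i.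
    by rewrite /u row_mxKl -[i in LHS]/(val (Ordinal lt_i)) coef_rVpoly_ord mxE.
  by rewrite /t row_mxKr -[i in LHS]/(val (Ordinal lt_i)) coef_rVpoly_ord mxE.
move=> w Tw; rewrite /f; have [-> -> _] := decP w Tw.
have [_ _ eu et] := decodeP (u w) led pth lst (tn w Tw).
rewrite -[RHS]hsubmxK; congr row_mx; apply/rowP => i; rewrite mxE.
  by rewrite eu // /u coef_rVpoly_ord.
by rewrite et // /t coef_rVpoly_ord.
Qed.

End Degrees.

Section Multiplication.
Variables d1 d2 k : nat.

Lemma fraction_Psi X j : fraction iota X (fun v => Psi L d1 d2 k v 0 j).
Proof.
have fl : poly_fraction iota X (fun v => monic_of (lsubmx (lsubmx v))).
  apply: poly_fraction_monic_of => i.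
  by apply: eq_fraction (fraction_coord _ _ (lshift _ (lshift _ i))) => x _; rewrite !mxE.
have fr : poly_fraction iota X (fun v => monic_of (rsubmx (lsubmx v))).
  apply: poly_fraction_monic_of => i.
  by apply: eq_fraction (fraction_coord _ _ (lshift _ (rshift _ i))) => x _; rewrite !mxE.
have fg := @poly_fraction_rsub _ _ X.
by apply: fraction_row_mx j => i; apply: fraction_coords; apply: poly_fractionM.
Qed.

(** Fixing s makes the monic gcd regular, and the cofactors are quotients by
    this monic polynomial of fixed degree. *)
Lemma fraction_unmul s j : last (minn d1 d2) s = k ->
  fraction iota (@stratum L d1 d2 s) (fun y => unmul k y 0 j).
Proof.
move=> lst; pose X := @stratum L d1 d2 s.
pose G (y : 'rV[L]_(d1 + d2)) := mgcd (monic_of (lsubmx y)) (monic_of (rsubmx y)).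
have mG : monic_family iota X k G.
  split=> [|y sy]; last first.
    have [/monic_neq0 n2 _] := monic_of_monic (rsubmx y).
    by rewrite mgcd_monic // (size_mgcd_stratum sy) lst.
  apply: (@eq_poly_fraction _ _ _ _ _ (fun y => mgcd (major y) (minor y))).
    by move=> y _; apply: mgcd_major_minor.
  exact: (@poly_fraction_mgcd _ _ _ _ s _ _ _ _ _
            (monic_family_major X) (monic_family_minor X)).
have m1 : monic_family iota X d1 (fun y => monic_of (lsubmx y)).
  by split=> [|y _]; [apply: poly_fraction_lsub | apply: monic_of_monic].
have m2 : monic_family iota X d2 (fun y => monic_of (rsubmx y)).
  by split=> [|y _]; [apply: poly_fraction_rsub | apply: monic_of_monic].
have [[q1 _] [q2 _]] := (monic_family_divmod m1 mG, monic_family_divmod m2 mG).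
have fG := mG.1.
apply: fraction_row_mx j => i; last exact: fraction_coords.
by apply: fraction_row_mx i => i; apply: fraction_coords.
Qed.

End Multiplication.
End Strata.

Theorem proposition1p3
    (K : fieldType) (L : closedFieldType) (iota : {rmorphism K -> L})
    (d1 d2 k : nat) (hk : (k <= minn d1 d2)%N) :
  let P := Poly1 L (d1 - k) (d2 - k) in
  let T := adiff (R1 L k d1 d2) (R1 L k.+1 d1 d2) in
  [/\ morphism iota (aprod P (affine L k)) T (Psi L d1 d2 k),
      asurjective (aprod P (affine L k)) T (Psi L d1 d2 k)
    & exists (N : nat) (C : 'I_N -> aset L ((d1 - k) + (d2 - k))),
      [/\ forall i, locally_closed iota (C i),
          forall v, P v <-> exists i, C i v,
          forall i j v, C i v -> C j v -> i = j,
          forall i, exists a b : nat,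
            isomorphic iota (C i) (affine_torus L a b)
        & forall i,
          let X := aprod (C i) (affine L k) in
          let W := aimage (Psi L d1 d2 k) X in
          [/\ asubset W T, locally_closed iota W
            & isomorphism iota X W (Psi L d1 d2 k)]]].
Proof.
move=> P T; split.
- by apply: morphism_fraction => [v /(Psi_common_factor hk)//|j]; apply: fraction_Psi.
- by move=> y /(Psi_unmul hk)[Xy yE]; exists (unmul k y).
pose ss := degree_seqs (minn (d1 - k) (d2 - k)).
pose C (i : 'I_(size ss)) := @stratum L (d1 - k) (d2 - k) (nth [::] ss i).
have ssC (i : 'I_(size ss)) : nth [::] ss i \in ss by apply: mem_nth.
have CP i v : C i v -> P v by move=> Cv; apply/Poly1_strata; exists (nth [::] ss i).
exists (size ss), C; split.
- by move=> i; apply: locally_closed_stratum.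
- move=> v; split=> [/Poly1_strata[s sss sv]|[i]]; last exact: CP.
  have lt_s := sss; rewrite -index_mem in lt_s.
  by exists (Ordinal lt_s); rewrite /C /= nth_index.
- move=> i j v Ci Cj; apply/val_inj/eqP => /=.
  by rewrite -(@nth_uniq _ [::] ss) ?undup_uniq // (euclid_inj Ci Cj).
- move=> i; exists (maxn (d1 - k) (d2 - k)), (size (nth [::] ss i)).
  exact: stratum_torus.
move=> i X W; set s := nth [::] ss i.
have XP v : X v -> aprod P (affine L k) v by move=> [/CP].
have WE y : W y <-> stratum (map (addn k) s) y by apply: image_stratum (ssC i).
have WT : asubset W T by move=> _ [v /XP Xv ->]; apply: Psi_common_factor.
have lst : last (minn d1 d2) (map (addn k) s) = k.
  have := ssC i; rewrite mem_degree_seqs => /andP[_ /eqP lst].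
  by rewrite -[minn d1 d2](subnKC hk) last_map subn_minl lst addn0.
split=> //.
  apply: eq_locally_closed (@locally_closed_stratum _ _ iota d1 d2 (map (addn k) s)).
  by move=> y; symmetry; apply: WE.
split; first by apply: morphism_fraction => [v Xv|j]; [exists v | apply: fraction_Psi].
exists (unmul k); split.
- apply: morphism_fraction => [_ [v Xv ->]|j]; first by rewrite unmulK //; apply: XP.
  by apply: sub_fraction (fraction_unmul iota j lst) => y /WE.
- by move=> v /XP/(unmulK hk).
by move=> y /WT/(Psi_unmul hk)[].
Qed.
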